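(* Let $G=K_1+C_5^{(1)}+C_5^{(2)}+C_5^{(3)}$, where $C_5^{(1)},C_5^{(2)},C_5^{(3)}$ are (pairwise vertex-disjoint) copies of the 5-cycle $C_5$. Then $G\to(3,4)$.
   Context: All graphs are finite, undirected, without loops or multiple edges. $K_n$ is the complete graph on $n$ vertices and $C_n$ is the simple cycle on $n$ vertices. For graphs $G_1,G_2$ without common vertices, $G_1+G_2$ denotes their join: $V(G_1+G_2)=V(G_1)\cup V(G_2)$ and $E(G_1+G_2)=E(G_1)\cup E(G_2)\cup\{[x,y]: x\in V(G_1),\,y\in V(G_2)\}$; this operation is associative. A $p$-clique of $G$ is a set of $p$ pairwise adjacent vertices. A blue-red coloring of $E(G)$ is a partition $E(G)=E_1\cup E_2$, $E_1\cap E_2=\emptyset$ (edges in $E_1$ are blue, edges in $E_2$ are red). A clique is blue (red) if all of its edges are blue (red). The coloring is $(p,q)$-free if there are no blue $p$-cliques and no red $q$-cliques. The notation $G\to(p,q)$ means that no blue-red coloring of $E(G)$ is $(p,q)$-free. *)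

(* Defs.v *)
From mathcomp Require Import all_boot.

Set Implicit Arguments.
Unset Strict Implicit.
Unset Printing Implicit Defensive.

Record sgraph := SGraph {
  vertex :> finType;
  adj : rel vertex;
  adj_sym : symmetric adj;
  adj_irr : irreflexive adj
}.

Definition edges (G : sgraph) : {set {set G}} :=
  [set [set x; y] | x in [set: G], y in adj x].

Section CompleteGraph.
Variable n : nat.

Definition complete_adj : rel 'I_n := fun i j => i != j.

Lemma complete_adj_sym : symmetric complete_adj.
Proof. by move=> i j; rewrite /complete_adj eq_sym. Qed.

Lemma complete_adj_irr : irreflexive complete_adj.
Proof. by move=> i; rewrite /complete_adj eqxx. Qed.

Definition complete_graph := SGraph complete_adj_sym complete_adj_irr.

End CompleteGraph.

Section CycleGraph.
Variable n : nat.

(* This is the n-cycle for 3 <= n; the condition i != j only matters for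
   n = 1, where ordS is the identity. *)
Definition cycle_adj : rel 'I_n :=
  fun i j => (i != j) && ((j == ordS i) || (i == ordS j)).

Lemma cycle_adj_sym : symmetric cycle_adj.
Proof. by move=> i j; rewrite /cycle_adj eq_sym orbC. Qed.

Lemma cycle_adj_irr : irreflexive cycle_adj.
Proof. by move=> i; rewrite /cycle_adj eqxx. Qed.

Definition cycle_graph := SGraph cycle_adj_sym cycle_adj_irr.

End CycleGraph.

Section Join.
Variables G1 G2 : sgraph.

(* The sum type makes the vertex sets disjoint, also when G1 and G2 are the
   same graph. *)
Definition join_adj : rel (G1 + G2)%type := fun u v =>
  match u, v with
  | inl x, inl y => adj x y
  | inr x, inr y => adj x y
  | _, _ => true
  end.

Lemma join_adj_sym : symmetric join_adj.
Proof. by move=> [x|x] [y|y] //=; apply: adj_sym. Qed.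

Lemma join_adj_irr : irreflexive join_adj.
Proof. by move=> [x|x] /=; apply: adj_irr. Qed.

Definition join := SGraph join_adj_sym join_adj_irr.

End Join.

Declare Scope graph_scope.
Delimit Scope graph_scope with graph.
Bind Scope graph_scope with sgraph.
Notation "G1 + G2" := (join G1 G2) : graph_scope.

Section Colorings.
Variable G : sgraph.

Definition clique (p : nat) (S : {set G}) : Prop :=
  #|S| = p /\ {in S &, forall x y, x != y -> adj x y}.

Definition coloring (E1 E2 : {set {set G}}) : Prop :=
  edges G = E1 :|: E2 /\ E1 :&: E2 = set0.

Definition monochromatic (E : {set {set G}}) (S : {set G}) : Prop :=
  {in S &, forall x y, adj x y -> [set x; y] \in E}.

Definition pq_free (p q : nat) (E1 E2 : {set {set G}}) : Prop :=
  (~ exists S : {set G}, clique p S /\ monochromatic E1 S) /\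
  (~ exists S : {set G}, clique q S /\ monochromatic E2 S).

Definition arrows (p q : nat) : Prop :=
  ~ exists E1 E2 : {set {set G}}, coloring E1 E2 /\ pq_free p q E1 E2.

End Colorings.

(* Main.v *)
Require Import Defs.
From mathcomp Require Import all_boot.

Set Implicit Arguments.
Unset Strict Implicit.
Unset Printing Implicit Defensive.

(** Let w be the vertex of K_1 and X, Y, Z the three 5-cycles, and suppose that
    a colouring has no blue triangle and no red 4-clique. The blue neighbours
    of any vertex span only red edges, and the red neighbours of w span no
    monochromatic triangle. The fact about C_5 used throughout is that it is
    not bipartite: two independent sets never exhaust it ([indep_missed]).

    The classical arrows K_6 -> (3,3) and K_3 + C_5 -> (3,3), applied to the
    red neighbourhood of w, leave one distribution of colours at w up to
    renaming the cycles: w is blue to all of X, red to all of Z, and its blue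
    neighbours in Y are independent ([no_red_K6], [blue_edge_False]). The cycle
    X is then red. For an edge xy of X, the vertices of Y and Z split into the
    blue neighbours of x, the blue neighbours of y, both spanning red edges
    only, and the vertices missed by x and y, which span blue edges only
    because a red edge among them would make a red 4-clique with x and y.

    If w has a blue neighbour v in Y, then v is missed by every edge xy, so x
    and y together are blue to a vertex cover of Z. Along a path v, b, a of Y
    with b and a red to w, one finds that vb is blue ([vb_blue]) and that Z is
    red ([Z_red]). Then for each edge xy of X exactly one of x and y is blue to
    both ends of some edge of Z, which is a 2-colouring of X
    ([blue_in_Y_False]).

    If w is red to all of Y, then Y and Z are monochromatic of one colour
    ([red_nbr_mono]). Write A x for the set of blue neighbours of x in Y. These
    sets are independent, and A x and A y cover the edges of Y when xy is an
    edge of X. When Y and Z are red, the union of A x and A t is independent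
    for x and t at distance two on X, and five such sets cannot go round X
    ([no_pentagram]). When Y and Z are blue, it is the sets missed by two
    consecutive edges of X whose union is independent; then every edge xy gives
    a 3-colouring of Y by A x, A y and the missed set, whose sense of rotation
    is antisymmetric in x and y and does not depend on y, so that it 2-colours
    X ([no_alternation]). *)

(** * Independent sets in the 5-cycle *)

Local Notation "i -- j" := (@cycle_adj 5 i j) (at level 70, no associativity).

Definition indep (f : pred 'I_5) := forall i j, i -- j -> f i -> f j -> False.

Local Notation o0 := (@Ordinal 5 0 isT).
Local Notation o1 := (@Ordinal 5 1 isT).
Local Notation o2 := (@Ordinal 5 2 isT).
Local Notation o3 := (@Ordinal 5 3 isT).
Local Notation o4 := (@Ordinal 5 4 isT).

Lemma C5_sym i j : i -- j -> j -- i.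
Proof. by rewrite cycle_adj_sym. Qed.

Lemma C5_not_bipartite (f : pred 'I_5) : (forall i j, i -- j -> f i = ~~ f j) -> False.
Proof.
move=> alt.
move: (alt o0 o1 isT) (alt o1 o2 isT) (alt o2 o3 isT) (alt o3 o4 isT) (alt o4 o0 isT).
by case: (f o0); case: (f o1); case: (f o2); case: (f o3); case: (f o4).
Qed.

Lemma indep_missed f g : indep f -> indep g -> exists i, ~~ f i /\ ~~ g i.
Proof.
move=> If Ig; case: (pickP (fun i => ~~ f i && ~~ g i)) => [i /andP[]|cov].
  by exists i.
have fg i : ~~ f i -> g i by move: (cov i); case: (f i); case: (g i).
case: (@C5_not_bipartite f) => i j ij.
case fi: (f i); case fj: (f j) => //.
  by case: (If i j ij).
by case: (Ig i j ij); apply: fg; rewrite ?fi ?fj.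
Qed.

Lemma indepP (f : pred 'I_5) : (exists i j, [/\ i -- j, f i & f j]) \/ indep f.
Proof.
case: (pickP (fun p : 'I_5 * 'I_5 => [&& p.1 -- p.2, f p.1 & f p.2])).
  by move=> [i j] /= /and3P[*]; left; exists i, j.
by move=> no; right=> i j ij fi fj; move: (no (i, j)); rewrite /= ij fi fj.
Qed.

(** Otherwise [f] and its complement would be two independent sets. *)
Lemma cover_edge f : indep (fun i => ~~ f i) -> exists i j, [/\ i -- j, f i & f j].
Proof.
by case: (indepP f) => // If nIf; have [i []] := indep_missed If nIf; case: (f i).
Qed.

(** The classes f, g, h form a 3-colouring of C_5, except that f and g may
    overlap. Reading the cycle in the direction of [ordS], exactly one of the
    patterns f g h and g f h occurs on three consecutive vertices, by inspection
    of the possible f and g. The colour of the middle vertex is determined by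
    its neighbours, so only the outer two are tested. *)
Lemma C5_orient f g h :
  (forall i, h i = ~~ f i && ~~ g i) -> indep f -> indep g -> indep h ->
  [exists r, f r && h (ordS (ordS r))] = ~~ [exists r, g r && h (ordS (ordS r))].
Proof.
have S0 : ordS o0 = o1 by apply: val_inj.
have S1 : ordS o1 = o2 by apply: val_inj.
have S2 : ordS o2 = o3 by apply: val_inj.
have S3 : ordS o3 = o4 by apply: val_inj.
have S4 : ordS o4 = o0 by apply: val_inj.
have ex (P : pred 'I_5) : [exists r, P r] = [|| P o0, P o1, P o2, P o3 | P o4].
  apply/existsP/idP => [[[[|[|[|[|[|m]]]]] lt] Pr]|].
  - by move: Pr; rewrite (bool_irrelevance lt isT) => ->.
  - by move: Pr; rewrite (bool_irrelevance lt isT) => ->; rewrite ?orbT.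
  - by move: Pr; rewrite (bool_irrelevance lt isT) => ->; rewrite ?orbT.
  - by move: Pr; rewrite (bool_irrelevance lt isT) => ->; rewrite ?orbT.
  - by move: Pr; rewrite (bool_irrelevance lt isT) => ->; rewrite ?orbT.
  - by [].
  by case/or4P => [|||/orP[]] Pr; [exists o0|exists o1|exists o2|exists o3|exists o4].
move=> hE If Ig Ih; rewrite !ex !(S0, S1, S2, S3, S4) !hE.
have ind e : indep e -> ~~ [|| e o0 && e o1, e o1 && e o2, e o2 && e o3, e o3 && e o4 | e o4 && e o0].
  by move=> Ie; apply/negP => /or4P[|||/orP[]] /andP[]; apply: Ie.
move: (ind _ If) (ind _ Ig) (ind _ Ih); rewrite !hE.
case: (f o0); case: (f o1) => //; case: (f o2) => //; case: (f o3) => //; case: (f o4) => //;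
case: (g o0); case: (g o1) => //; case: (g o2) => //; case: (g o3) => //; case: (g o4) => //.
Qed.

Lemma C5_succ i : i -- ordS i.
Proof. by case: i => [[|[|[|[|[|m]]]]] lt]. Qed.

Lemma C5_walk k : exists k1 k2 k3 k4, [/\ k -- k1, k1 -- k2, k2 -- k3, k3 -- k4 & k4 -- k].
Proof.
pose s := @ordS 5; exists (s k), (s (s k)), (s (s (s k))), (s (s (s (s k)))).
split; try exact: C5_succ.
by case: k => [[|[|[|[|[|m]]]]] lt].
Qed.

Lemma C5_edges_const (g : 'I_5 -> 'I_5 -> bool) :
    (forall i j, g i j = g j i) ->
    (forall i j k, i -- j -> j -- k -> g i j = g j k) ->
  forall i j, i -- j -> g i j = g o0 o1.
Proof.
move=> gC step.
have succ i : g i (ordS i) = g o0 o1.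
  have S i0 : g (ordS i0) (ordS (ordS i0)) = g i0 (ordS i0).
    by rewrite -(step i0) //; apply: C5_succ.
  have [n ->] : exists n, i = iter n (@ordS 5) o0.
    by exists i; case: i => [[|[|[|[|[|m]]]]] lt] //; apply: val_inj.
  elim: n => [|n IHn]; last by rewrite iterS S.
  by congr (g _ _); apply: val_inj.
by move=> i j /andP[_ /orP[/eqP->|/eqP->]]; rewrite // gC.
Qed.

(** * Families of independent sets indexed by a 5-cycle *)

Section Families.
Variable A : 'I_5 -> pred 'I_5.

(** Some edge ab of the inner cycle has a in A 0 and b in A 1. The index 3 is at
    distance two from both 0 and 1, so A 3 contains neither a nor b; covering ab
    then puts a into A 2 and b into A 4, which are at distance two as well.
    Taking x = t in the second hypothesis makes each A x independent. *)
Lemma no_pentagram :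
    (forall x y, x -- y -> indep (fun i => ~~ A x i && ~~ A y i)) ->
    (forall x y t i j, x -- y -> y -- t -> i -- j -> A x i -> A t j -> False) ->
  False.
Proof.
move=> cov far.
have key a b : a -- b -> A o0 a -> A o1 b -> False.
  move=> ab A0a A1b; have ba := C5_sym ab.
  have nA3a : ~~ A o3 a by apply/negP => A3a; apply: (far o3 o2 o1 a b).
  have nA3b : ~~ A o3 b by apply/negP => A3b; apply: (far o3 o4 o0 b a).
  have nA2b : ~~ A o2 b by apply/negP => A2b; apply: (far o2 o1 o0 b a).
  have nA4a : ~~ A o4 a by apply/negP => A4a; apply: (far o4 o0 o1 a b).
  have A2a : A o2 a.
    apply/negPn/negP => nA2a.
    by apply: (cov o2 o3 isT a b ab); rewrite ?nA2a ?nA2b ?nA3a ?nA3b.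
  have A4b : A o4 b.
    apply/negPn/negP => nA4b.
    by apply: (cov o4 o3 isT a b ab); rewrite ?nA4a ?nA4b ?nA3a ?nA3b.
  exact: (far o2 o3 o4 a b).
have cov01 : indep (fun i => ~~ (A o0 i || A o1 i)).
  by move=> i j ij; rewrite !negb_or; apply: cov ij.
have [a [b [ab /orP[A0a|A1a] /orP[A0b|A1b]]]] := cover_edge cov01.
- exact: (far o0 o1 o0 a b).
- exact: (key a b).
- by apply: (key b a) => //; apply: C5_sym.
- exact: (far o1 o0 o1 a b).
Qed.

(** Let P x y be the complement of the union of A x and A y. The pattern A x,
    A y, P x y occurs in the direction of [ordS] for exactly one order of x and
    y, by [C5_orient], and [near] makes its occurrence independent of the
    neighbour y. It therefore defines a 2-colouring of the index cycle. *)
Lemma no_alternation :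
    (forall x, indep (A x)) ->
    (forall x y t i j, x -- y -> x -- t -> i -- j ->
       ~~ A x i -> ~~ A y i -> ~~ A x j -> ~~ A t j -> False) ->
  False.
Proof.
move=> indA near.
pose P x y := [pred i | ~~ A x i && ~~ A y i].
pose turn x y := [exists r, A x r && P x y (ordS (ordS r))].
have turnC x y : x -- y -> turn x y = ~~ turn y x.
  move=> xy; have -> : turn y x = [exists r, A y r && P x y (ordS (ordS r))].
    by apply: eq_existsb => r; rewrite /= [X in _ && X]andbC.
  apply: C5_orient => // i j ij /= /andP[xi yi] /andP[xj yj].
  exact: (near x y y i j).
have turn_indep x y t : x -- y -> x -- t -> turn x y -> turn x t.
  move=> xy xt /existsP[r /and3P[Axr nx2 ny2]]; apply/existsP; exists r.
  rewrite /= Axr nx2 /=; apply/negP => At2.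
  have r12 := C5_succ (ordS r).
  have nx1 : ~~ A x (ordS r) by apply/negP; apply: (indA x) (C5_succ r) Axr.
  have [At1|nt1] := boolP (A t (ordS r)); first exact: (indA t) r12 At1 At2.
  exact: (near x y t _ _ xy xt (C5_sym r12)).
apply: (@C5_not_bipartite (fun x => turn x (ordS x))) => x y xy.
have turnE z t : z -- t -> turn z (ordS z) = turn z t.
  by move=> zt; apply/idP/idP; apply: turn_indep => //; apply: C5_succ.
by rewrite (turnE _ _ xy) (turnE _ _ (C5_sym xy)) turnC.
Qed.

End Families.

(** * Colourings without blue triangles and red 4-cliques *)

(** An edge uv is blue when [c u v] holds and red otherwise. *)
Section Coloring.
Variables (G : sgraph) (c : rel G).

Record cone (w : G) (X Y Z : 'I_5 -> G) : Prop := Cone {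
  apexX : forall i, adj w (X i);
  apexY : forall i, adj w (Y i);
  apexZ : forall i, adj w (Z i);
  cycleX : forall i j, i -- j -> adj (X i) (X j);
  cycleY : forall i j, i -- j -> adj (Y i) (Y j);
  cycleZ : forall i j, i -- j -> adj (Z i) (Z j);
  joinXY : forall i j, adj (X i) (Y j);
  joinXZ : forall i j, adj (X i) (Z j);
  joinYZ : forall i j, adj (Y i) (Z j)
}.

Lemma adjC (u v : G) : adj u v -> adj v u.
Proof. by rewrite adj_sym. Qed.

Hypothesis cC : symmetric c.
Hypothesis no_blue : forall u v t,
  adj u v -> adj u t -> adj v t -> c u v -> c u t -> c v t -> False.
Hypothesis no_red : forall u v t s,
  adj u v -> adj u t -> adj u s -> adj v t -> adj v s -> adj t s ->
  ~~ c u v -> ~~ c u t -> ~~ c u s -> ~~ c v t -> ~~ c v s -> ~~ c t s -> False.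

Lemma blueC u v : c u v -> c v u. Proof. by rewrite cC. Qed.
Lemma redC u v : ~~ c u v -> ~~ c v u. Proof. by rewrite cC. Qed.

Lemma red_between u v t :
  adj u v -> adj u t -> adj v t -> c u v -> c u t -> ~~ c v t.
Proof. by move=> uv ut vt cuv cut; apply/negP; apply: (@no_blue u v t). Qed.

#[local] Hint Immediate adjC blueC redC C5_sym : core.
#[local] Hint Resolve apexX apexY apexZ cycleX cycleY cycleZ joinXY joinXZ joinYZ : core.

Lemma cone_swapYZ w X Y Z : cone w X Y Z -> cone w X Z Y.
Proof. by case=> *; split; auto. Qed.

Lemma cone_swapXY w X Y Z : cone w X Y Z -> cone w Y X Z.
Proof. by case=> *; split; auto. Qed.

Section BlueCycle.
Variables (w : G) (X Y Z : 'I_5 -> G).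
Hypothesis wXYZ : cone w X Y Z.
Hypothesis wX : forall i, c w (X i).
Hypothesis wZ : forall i, ~~ c w (Z i).

Let aX := apexX wXYZ.
Let aY := apexY wXYZ.
Let aZ := apexZ wXYZ.
Let XX := cycleX wXYZ.
Let YY := cycleY wXYZ.
Let ZZ := cycleZ wXYZ.
Let XY := joinXY wXYZ.
Let XZ := joinXZ wXYZ.
Let YZ := joinYZ wXYZ.
#[local] Hint Resolve aX aY aZ XX YY ZZ XY XZ YZ wX wZ : core.

Lemma redX x y : x -- y -> ~~ c (X x) (X y).
Proof. by move=> xy; apply/negP => xyb; apply: (@no_blue w (X x) (X y)); auto. Qed.
#[local] Hint Resolve redX : core.

Lemma blue_near x y u t :
  x -- y -> (forall k, adj (X k) u) -> (forall k, adj (X k) t) -> adj u t ->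
  ~~ c (X x) u -> ~~ c (X y) u -> ~~ c (X x) t -> ~~ c (X y) t -> c u t.
Proof.
move=> xy Xu Xt ut xu yu xt yt; apply/negPn/negP => nut.
by apply: (@no_red (X x) (X y) u t); auto.
Qed.

(** ** A blue neighbour of the apex in Y *)

Section Path.
Variables v b a : 'I_5.
Hypotheses (vb : v -- b) (ba : b -- a).
Hypotheses (wv : c w (Y v)) (wb : ~~ c w (Y b)) (wa : ~~ c w (Y a)).

Lemma redXv x : ~~ c (X x) (Y v).
Proof. by apply/negP => xv; apply: (@no_blue w (X x) (Y v)); auto. Qed.
#[local] Hint Resolve redXv : core.

(** The vertex v is missed by xy, so an edge of Z missed by xy would form a blue
    triangle with v. *)
Lemma coverZ x y :
  x -- y -> indep (fun i => ~~ c (X x) (Z i) && ~~ c (X y) (Z i)).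
Proof.
move=> xy i j ij /andP[xi yi] /andP[xj yj].
by apply: (@no_blue (Y v) (Z i) (Z j)); auto; apply: (@blue_near x y); auto.
Qed.

Lemma red_at_v u :
  (forall k, adj (X k) u) -> adj (Y v) u -> ~~ c (Y v) u ->
  indep (fun x => ~~ c (X x) u).
Proof.
by move=> Xu vu nvu x y xy nx ny; apply: (@no_red (X x) (X y) (Y v) u); auto.
Qed.

(** The blue neighbours of u in X form a vertex cover of X, because v is red to
    X, and so do those of t; two vertex covers of a C_5 meet. *)
Lemma red_link u t :
  (forall k, adj (X k) u) -> (forall k, adj (X k) t) ->
  adj (Y v) u -> adj (Y v) t -> adj u t ->
  ~~ c (Y v) u -> ~~ c (Y v) t -> ~~ c u t.
Proof.
move=> Xu Xt vu vt ut nvu nvt; apply/negP => but.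
have [x []] := indep_missed (red_at_v Xu vu nvu) (red_at_v Xt vt nvt).
by move=> /negPn xu /negPn xt; apply: (@no_blue (X x) u t).
Qed.

(** If vb were red, some edge xy of X would be blue to b, so that b would be red
    to the blue neighbours of x and y in Z, which cover Z. An edge zt among them
    is blue, hence ab is blue. So a is missed by xy and is blue to the vertices
    of Z missed by xy, to which b is therefore red. But then b is red to all of
    Z, and an edge of Z whose ends have the same colour to v, which is red,
    forms a red 4-clique with b and v or with b and w. *)
Lemma vb_blue : c (Y v) (Y b).
Proof.
apply/negPn/negP => nvb.
have Sb : indep (fun x => ~~ c (X x) (Y b)) by apply: red_at_v; auto.
have [x [y [xy xb yb]]] := cover_edge Sb.
have bred z : c (X x) (Z z) || c (X y) (Z z) -> ~~ c (Y b) (Z z).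
  by case/orP=> ?; apply/negP => ?; [apply: (@no_blue (X x) (Y b) (Z z))
                                   |apply: (@no_blue (X y) (Y b) (Z z))]; auto.
have cov : indep (fun i => ~~ (c (X x) (Z i) || c (X y) (Z i))).
  by move=> i j ij; rewrite !negb_or; apply: coverZ ij.
have [z [t [zt /bred bz /bred bt]]] := cover_edge cov.
(* Otherwise w, b, z, t is a red 4-clique. *)
have ztb : c (Z z) (Z t).
  by apply/negPn/negP => nzt; apply: (@no_red w (Y b) (Z z) (Z t)); auto.
have abb : c (Y b) (Y a).
  apply/negPn/negP => nba.
  have az : c (Y a) (Z z).
    by apply/negPn/negP => naz; apply: (@no_red w (Y b) (Y a) (Z z)); auto.
  have at_ : c (Y a) (Z t).
    by apply/negPn/negP => naz; apply: (@no_red w (Y b) (Y a) (Z t)); auto.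
  by apply: (@no_blue (Y a) (Z z) (Z t)); auto.
have nax : ~~ c (X x) (Y a).
  by apply/negP => xa; apply: (@no_blue (X x) (Y b) (Y a)); auto.
have nay : ~~ c (X y) (Y a).
  by apply/negP => xa; apply: (@no_blue (X y) (Y b) (Y a)); auto.
have bZ i : ~~ c (Y b) (Z i).
  have [/bred//|] := boolP (c (X x) (Z i) || c (X y) (Z i)).
  rewrite negb_or => /andP[nx ny]; apply/negP => bi.
  apply: (@no_blue (Y b) (Y a) (Z i)); auto.
  by apply: (@blue_near x y); auto.
have Zr : indep (fun i => ~~ c (Y v) (Z i)).
  move=> i j ij vi vj; apply: (@no_red (Y v) (Y b) (Z i) (Z j)); auto.
  by apply: red_link; auto.
have Zb : indep (fun i => c (Y v) (Z i)).
  move=> i j ij vi vj; apply: (@no_red w (Y b) (Z i) (Z j)); auto.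
  by apply/negP => zij; apply: (@no_blue (Y v) (Z i) (Z j)); auto.
by have [i []] := indep_missed Zr Zb; case: (c (Y v) (Z i)).
Qed.

Let vbb := vb_blue.
#[local] Hint Resolve vbb : core.

Lemma b_red i : c (Y v) (Z i) -> ~~ c (Y b) (Z i).
Proof. by move=> vi; apply/negP => bi; apply: (@no_blue (Y v) (Y b) (Z i)); auto. Qed.

Lemma Zb_indep : indep (fun i => c (Y v) (Z i)).
Proof.
move=> i j ij vi vj; apply: (@no_red w (Y b) (Z i) (Z j)); auto using b_red.
by apply/negP => zij; apply: (@no_blue (Y v) (Z i) (Z j)); auto.
Qed.

Lemma missed_v x y i :
  x -- y -> ~~ c (X x) (Z i) -> ~~ c (X y) (Z i) -> c (Y v) (Z i).
Proof. by move=> xy nx ny; apply: (@blue_near x y); auto. Qed.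

(** A vertex of Z missed by xy is blue to every vertex of Y missed by xy. *)
Lemma coverY x y i :
  x -- y -> ~~ c (X x) (Z i) -> ~~ c (X y) (Z i) ->
  indep (fun j => ~~ c (X x) (Y j) && ~~ c (X y) (Y j)).
Proof.
move=> xy nx ny j k jk /andP[xj yj] /andP[xk yk].
by apply: (@no_blue (Z i) (Y j) (Y k)); auto; apply: (@blue_near x y); auto.
Qed.

Lemma blueX_red_w x j : c (X x) (Y j) -> ~~ c w (Y j).
Proof. by move=> xj; apply/negP => wj; apply: (@no_blue w (X x) (Y j)); auto. Qed.

(** An edge of Z blue to x would form a red 4-clique with w and [Y j]. *)
Lemma mixed_indepZ x j : c (X x) (Y j) -> indep (fun i => c (X x) (Z i)).
Proof.
move=> xj i k ik xi xk; have wj := blueX_red_w xj.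
by apply: (@no_red w (Y j) (Z i) (Z k)); auto; apply: (@red_between (X x)); auto.
Qed.

(** The vertex [Z k] is blue to both ends of an edge st of X, and [Z i] is missed
    by st. The blue neighbours of s in Y are red to [Z k], hence independent, and
    so are those of t; by [coverY] they cover together the edges of Y, so neither
    set is empty, and [mixed_indepZ] applies to s and to t. Thus both neighbours
    of k in Z are missed by st and are blue to v. The rest of Z is an edge with
    one end blue to s and the other to t, and b is blue to s or t; the end p on
    the side of b is then joined by a blue edge to its common neighbour j with
    k, which puts p in the situation of k. *)
Lemma blue_edge_Z i k :
  i -- k -> c (Y v) (Z i) -> ~~ c (Y v) (Z k) -> c (Z i) (Z k) ->
  (forall j, j -- k -> c (Y v) (Z j)) /\
  exists j p q r, [/\ k -- j, j -- p, p -- q, q -- r & r -- k] /\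
    [/\ c (Y v) (Z j), ~~ c (Y v) (Z p) & c (Z j) (Z p)].
Proof.
move=> ik vi nvk bik.
have [s [t [st sk tk]]] : exists s t, [/\ s -- t, c (X s) (Z k) & c (X t) (Z k)].
  by apply: cover_edge; apply: red_at_v; auto.
have nXi x : c (X x) (Z k) -> ~~ c (X x) (Z i).
  by move=> xk; apply/negP => xi; apply: (@no_blue (X x) (Z i) (Z k)); auto.
have cov := coverY st (nXi _ sk) (nXi _ tk).
have indY x : c (X x) (Z k) -> indep (fun j => c (X x) (Y j)).
  move=> xk j l jl xj xl; have wj := blueX_red_w xj; have wl := blueX_red_w xl.
  by apply: (@no_red w (Y j) (Y l) (Z k)); auto; apply: (@red_between (X x)); auto.
have inY x y : x -- y -> c (X x) (Z k) -> c (X y) (Z k) -> indep (fun j => c (X x) (Z j)).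
  move=> xy xk yk; have cov' := coverY xy (nXi _ xk) (nXi _ yk).
  case: (pickP (fun j => c (X x) (Y j))) => [j xj|no]; first exact: mixed_indepZ xj.
  have cy : indep (fun j => ~~ c (X y) (Y j)).
    by move=> j l jl nj nl; apply: (cov' j l); rewrite ?no ?nj ?nl.
  by have [j []] := indep_missed (indY y yk) cy; case: (c (X y) (Y j)).
have near y : y -- k -> c (Y v) (Z y) /\ ~~ c (X s) (Z y) && ~~ c (X t) (Z y).
  move=> yk.
  have ns : ~~ c (X s) (Z y) by apply/negP => sy; apply: (inY s t _ _ _ y k).
  have nt : ~~ c (X t) (Z y) by apply/negP => ty; apply: (inY t s _ _ _ y k); auto.
  by rewrite ns nt; split=> //; apply: (missed_v st).
split=> [j /near[]//|].
have [k1 [k2 [k3 [k4 [e1 e2 e3 e4 e5]]]]] := C5_walk k.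
have [v1 n1] := near k1 (C5_sym e1); have [v4 n4] := near k4 e5.
have far x y : x -- y -> c (X x) (Z k) -> c (X y) (Z k) ->
    ~~ c (X x) (Z k1) && ~~ c (X y) (Z k1) ->
    ~~ c (X x) (Z k4) && ~~ c (X y) (Z k4) ->
    c (X x) (Z k2) || c (X x) (Z k3).
  move=> xy xk yk m1 m4; apply/negPn/negP; rewrite negb_or => /andP[x2 x3].
  apply: (inY y x _ _ _ k2 k3); auto.
    by apply/negPn/negP => y2; apply: (coverZ xy e2); rewrite ?x2 ?y2.
  by apply/negPn/negP => y3; apply: (coverZ xy (C5_sym e4)); rewrite ?x3 ?y3.
have finish x j p : j -- p -> c (Y v) (Z j) -> c (X x) (Y b) -> c (X x) (Z p) ->
    [/\ c (Y v) (Z j), ~~ c (Y v) (Z p) & c (Z j) (Z p)].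
  move=> jp vj xb xp; split=> //; first by apply/negP => vp; apply: Zb_indep jp vj vp.
  apply/negPn/negP => njp; apply: (@no_red w (Y b) (Z j) (Z p)); auto.
    exact: b_red.
  by apply: (@red_between (X x)); auto.
have wrap x : c (X x) (Y b) -> c (X x) (Z k2) || c (X x) (Z k3) ->
    exists j p q r, [/\ k -- j, j -- p, p -- q, q -- r & r -- k] /\
      [/\ c (Y v) (Z j), ~~ c (Y v) (Z p) & c (Z j) (Z p)].
  move=> xb /orP[x2|x3].
    by exists k1, k2, k3, k4; split; [split|apply: finish x2].
  by exists k4, k3, k2, k1; split; [split; auto|apply: finish x3; auto].
have [sb|nsb] := boolP (c (X s) (Y b)).
  by apply: (wrap s) => //; apply: (far s t).
have [tb|ntb] := boolP (c (X t) (Y b)).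
  by apply: (wrap t) => //; apply: (far t s); rewrite 1?andbC; auto.
by case: (cov v b); rewrite ?redXv ?nsb ?ntb.
Qed.

(** By [Zb_indep] and [red_link], a blue edge of Z has exactly one end blue to v.
    Then [blue_edge_Z] applies to its other end, and again to a vertex p at
    distance two from it. The neighbours of these two vertices in Z are all blue
    to v, and two of them are adjacent. *)
Lemma Z_red i j : i -- j -> ~~ c (Z i) (Z j).
Proof.
have mixed k l : k -- l -> c (Y v) (Z k) -> ~~ c (Y v) (Z l) -> ~~ c (Z k) (Z l).
  move=> kl vk nvl; apply/negP => bkl.
  have [nbl [m [p [q [r [[lm mp pq qr rl] [vm nvp bmp]]]]]]] := blue_edge_Z kl vk nvl bkl.
  have [nbp _] := blue_edge_Z mp vm nvp bmp.
  by apply: (Zb_indep qr); [apply: nbp; auto|apply: nbl].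
move=> ij; have [vi|nvi] := boolP (c (Y v) (Z i)); have [vj|nvj] := boolP (c (Y v) (Z j)).
- by case: (Zb_indep ij).
- exact: mixed.
- by apply: redC; apply: mixed; auto.
- by apply: red_link; auto.
Qed.

(** Since Z is red and has no red triangle with w, every vertex of Y red to w is
    red to an independent set of Z; in particular ab is red. If neither of two
    adjacent x and y were blue to an edge of Z, then Z would have a vertex
    missed by xy, so b would be blue to x or y, which [clash] excludes. If both
    were, then a and b would be missed by xy and ab would be blue. *)
Lemma blue_in_Y_False : False.
Proof.
have indep_red j : ~~ c w (Y j) -> indep (fun i => ~~ c (Y j) (Z i)).
  move=> wj k l kl nk nl; apply: (@no_red w (Y j) (Z k) (Z l)); auto.
  exact: Z_red.
have ab_red : ~~ c (Y b) (Y a).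
  apply/negP => bab; have [i []] := indep_missed (indep_red b wb) (indep_red a wa).
  by move=> /negPn bi /negPn ai; apply: (@no_blue (Y b) (Y a) (Z i)); auto.
pose J x := [exists i, [exists j, [&& i -- j, c (X x) (Z i) & c (X x) (Z j)]]].
have JP x : ~~ J x -> indep (fun i => c (X x) (Z i)).
  move=> nJ i j ij xi xj; case/negP: nJ; apply/existsP; exists i.
  by apply/existsP; exists j; rewrite ij xi xj.
have JY x j : J x -> ~~ c (X x) (Y j).
  move=> /existsP[i /existsP[k /and3P[ik xi xk]]]; apply/negP => xj.
  exact: (mixed_indepZ xj ik).
apply: (@C5_not_bipartite J) => x y xy.
have [Jx|nJx] := boolP (J x); have [Jy|nJy] := boolP (J y) => //.
  by case/negP: ab_red; apply: (@blue_near x y); auto.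
have [i [xi yi]] := indep_missed (JP x nJx) (JP y nJy).
(* The blue neighbours of z in Z and the vertices missed by zt are all red to b,
   so they lie in an independent set, which together with the blue neighbours
   of t exhausts Z. *)
have clash z t : z -- t -> indep (fun i => c (X t) (Z i)) -> c (X z) (Y b) -> False.
  move=> zt It zb.
  have Ib : indep (fun i => ~~ c (Y b) (Z i)) by apply: indep_red.
  have [k [bk tk]] := indep_missed Ib It; move/negPn in bk.
  have [zk|nzk] := boolP (c (X z) (Z k)).
    by apply: (@no_blue (X z) (Y b) (Z k)); auto.
  by move: (b_red (missed_v zt nzk tk)); rewrite bk.
have [xb|nxb] := boolP (c (X x) (Y b)); first by case: (clash x y); auto.
have [yb|nyb] := boolP (c (X y) (Y b)); first by case: (clash y x); auto.
by case: (coverY xy xi yi vb); rewrite ?redXv ?nxb ?nyb.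
Qed.
End Path.
End BlueCycle.

(** * The red neighbourhood of the apex *)

Section RedNeighbourhood.
Variable w : G.
Definition red_nbr u := adj w u /\ ~~ c w u.

Lemma red_nbr_triangle u a b : red_nbr u -> red_nbr a -> red_nbr b ->
  adj u a -> adj u b -> adj a b -> c u a = c u b -> c u a = c a b -> False.
Proof.
move=> [wu nu] [wa na] [wb nb] ua ub ab e1 e2.
have [cab|nab] := boolP (c a b).
  by apply: (@no_blue u a b); rewrite // -?e1 e2.
by apply: (@no_red w u a b); rewrite // -?e1 e2.
Qed.

(** If u has colour k to a, b and d, then none of the edges between a, b and d
    has colour k, so they form a triangle of the other colour. *)
Lemma red_nbr_star u a b d : red_nbr u -> red_nbr a -> red_nbr b -> red_nbr d ->
  adj u a -> adj u b -> adj u d -> adj a b -> adj a d -> adj b d ->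
  c u a = c u b -> c u a = c u d -> False.
Proof.
move=> Bu Ba Bb Bd ua ub ud ab ad bd eb ed.
have tri p q : red_nbr p -> red_nbr q -> adj u p -> adj u q -> adj p q ->
    c u p = c u a -> c u q = c u a -> c p q = ~~ c u a.
  move=> Bp Bq up uq pq ep eq; have := @red_nbr_triangle u p q Bu Bp Bq up uq pq.
  by rewrite ep eq; case: (c u a); case: (c p q) => // /(_ erefl erefl).
have e1 : c a b = ~~ c u a by apply: tri.
have e2 : c a d = ~~ c u a by apply: tri.
have e3 : c b d = ~~ c u a by apply: tri.
by apply: (@red_nbr_triangle a b d); rewrite // e1 ?e2 ?e3.
Qed.

(** The vertices of the 5-cycle joined to u with the colour of ua are
    independent by [red_nbr_star], and likewise for ua'. If the two colours
    differed, these two sets would exhaust the cycle. *)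
Lemma red_nbr_fan u a a' (f : 'I_5 -> G) :
  red_nbr u -> red_nbr a -> red_nbr a' -> (forall i, red_nbr (f i)) ->
  adj u a -> adj u a' -> (forall i j, i -- j -> adj (f i) (f j)) ->
  (forall i, adj u (f i)) -> (forall i, adj a (f i)) -> (forall i, adj a' (f i)) ->
  c u a = c u a'.
Proof.
move=> Bu Ba Ba' Bf ua ua' ff uf af a'f.
have I p : red_nbr p -> adj u p -> (forall i, adj p (f i)) ->
    indep (fun i => c u (f i) == c u p).
  move=> Bp up pf i j ij /eqP ei /eqP ej.
  by apply: (@red_nbr_star u p (f i) (f j)); auto.
have [i []] := indep_missed (I a Ba ua af) (I a' Ba' ua' a'f).
by case: (c u (f i)); case: (c u a); case: (c u a').
Qed.

(** ** Two cycles in the red neighbourhood *)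

Record mono (X Y Z : 'I_5 -> G) (k : bool) : Prop := Mono {
  mono_cone : cone w X Y Z;
  mono_X : forall i, c w (X i);
  mono_Y : forall i, ~~ c w (Y i);
  mono_Z : forall i, ~~ c w (Z i);
  mono_YY : forall i j, i -- j -> c (Y i) (Y j) = k;
  mono_ZZ : forall i j, i -- j -> c (Z i) (Z j) = k
}.

Lemma mono_swap X Y Z k : mono X Y Z k -> mono X Z Y k.
Proof. by case=> *; split; auto; apply: cone_swapYZ. Qed.

(** Each cycle has constant colour by [red_nbr_fan] with the other cycle. If the
    colours differed, the vertices of Z joined to Y 0 with the colour of Y
    would be independent by [red_nbr_star], and the others by
    [red_nbr_triangle]. *)
Lemma red_nbr_mono X Y Z : cone w X Y Z -> (forall i, c w (X i)) ->
  (forall i, ~~ c w (Y i)) -> (forall i, ~~ c w (Z i)) -> exists k, mono X Y Z k.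
Proof.
move=> wXYZ wX wY wZ.
have BY i : red_nbr (Y i) by split; auto; apply: apexY wXYZ i.
have BZ i : red_nbr (Z i) by split; auto; apply: apexZ wXYZ i.
have YZ := joinYZ wXYZ; have YY := cycleY wXYZ; have ZZ := cycleZ wXYZ.
have constY : forall i j, i -- j -> c (Y i) (Y j) = c (Y o0) (Y o1).
  apply: (@C5_edges_const (fun i j => c (Y i) (Y j))) => [i j|i j k ij jk]; first exact: cC.
  by rewrite cC; apply: (@red_nbr_fan _ _ _ Z); auto.
have constZ : forall i j, i -- j -> c (Z i) (Z j) = c (Z o0) (Z o1).
  apply: (@C5_edges_const (fun i j => c (Z i) (Z j))) => [i j|i j k ij jk]; first exact: cC.
  by rewrite cC; apply: (@red_nbr_fan _ _ _ Y); auto.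
exists (c (Y o0) (Y o1)); split=> // i j ij; rewrite constZ //.
apply/eqP/negPn/negP => ne; set k := c (Y o0) (Y o1) in ne.
have Ik : indep (fun l => c (Y o0) (Z l) == k).
  move=> p q pq /eqP ep /eqP eq.
  by apply: (@red_nbr_star (Y o0) (Y o1) (Z p) (Z q)); auto; apply: YY.
have Ink : indep (fun l => c (Y o0) (Z l) != k).
  have neq (x y z : bool) : x != z -> y != z -> x = y by case: x y z => [] [] [].
  move=> p q pq np nq; apply: (@red_nbr_triangle (Y o0) (Z p) (Z q)); auto.
    exact: neq np nq.
  by apply: neq np _; rewrite constZ.
by have [l []] := indep_missed Ik Ink; case: eqP.
Qed.

(** ** Both cycles red *)

Section RedCycles.
Variables X Y Z : 'I_5 -> G.
Hypothesis M : mono X Y Z false.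

Let C := mono_cone M.
Let wX := mono_X M.
Let wY := mono_Y M.
Let wZ := mono_Z M.
Let aX := apexX C.
Let aY := apexY C.
Let aZ := apexZ C.
Let XX := cycleX C.
Let YY := cycleY C.
Let ZZ := cycleZ C.
Let XY := joinXY C.
Let XZ := joinXZ C.
Let YZ := joinYZ C.

Lemma mono_red i j : i -- j -> ~~ c (Y i) (Y j).
Proof. by move=> ij; rewrite (mono_YY M ij). Qed.
#[local] Hint Resolve aX aY aZ XX YY ZZ XY XZ YZ wX wY wZ mono_red : core.

Lemma red_cover x y : x -- y -> indep (fun i => ~~ c (X x) (Y i) && ~~ c (X y) (Y i)).
Proof.
move=> xy i j ij /andP[xi yi] /andP[xj yj]; case/negP: (mono_red ij).
by apply: (blue_near C wX xy); auto.
Qed.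

Lemma red_split x i j l :
  i -- j -> c (X x) (Y i) -> c (X x) (Y j) -> ~~ c (X x) (Z l).
Proof.
move=> ij xi xj; apply/negP => xl.
have R k : c (X x) (Y k) -> ~~ c (Y k) (Z l).
  by move=> xk; apply/negP => ?; apply: (@no_blue (X x) (Y k) (Z l)); auto.
by apply: (@no_red w (Y i) (Y j) (Z l)); auto.
Qed.
End RedCycles.

(** If x is blue to an edge of one cycle, it is red to the whole other cycle, so
    its neighbours on X are blue to an edge of that other cycle. Going once
    around X takes an odd number of such steps, so x is also blue to an edge of
    the other cycle. *)
Lemma red_indep X Y Z : mono X Y Z false -> forall x, indep (fun i => c (X x) (Y i)).
Proof.
move=> M; have M' := mono_swap M.
have flip U V : mono X U V false -> forall x y i j,
    x -- y -> i -- j -> c (X x) (U i) -> c (X x) (U j) ->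
    exists k l, [/\ k -- l, c (X y) (V k) & c (X y) (V l)].
  move=> N x y i j xy ij xi xj; apply: cover_edge => k l kl nk nl.
  apply: (red_cover (mono_swap N) xy kl);
  by rewrite ?nk ?nl (red_split N _ ij).
move=> x0 i0 j0 ij0 xi0 xj0.
have [x1 [x2 [x3 [x4 [e1 e2 e3 e4 e5]]]]] := C5_walk x0.
have [i1 [j1 [ij1 xi1 xj1]]] := flip _ _ M _ _ _ _ e1 ij0 xi0 xj0.
have [i2 [j2 [ij2 xi2 xj2]]] := flip _ _ M' _ _ _ _ e2 ij1 xi1 xj1.
have [i3 [j3 [ij3 xi3 xj3]]] := flip _ _ M _ _ _ _ e3 ij2 xi2 xj2.
have [i4 [j4 [ij4 xi4 xj4]]] := flip _ _ M' _ _ _ _ e4 ij3 xi3 xj3.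
have [i5 [j5 [ij5 xi5 xj5]]] := flip _ _ M _ _ _ _ e5 ij4 xi4 xj4.
by move: (red_split M i5 ij0 xi0 xj0); rewrite xi5.
Qed.

(** Together x and y are blue to an edge of Z; a common blue neighbour in Y would
    be red to both its ends. *)
Lemma red_disjoint X Y Z : mono X Y Z false ->
  forall x y i, x -- y -> c (X x) (Y i) -> ~~ c (X y) (Y i).
Proof.
move=> M x y i xy xi; apply/negP => yi.
have C := mono_cone M; have wY := mono_Y M; have wZ := mono_Z M.
have aY := apexY C; have aZ := apexZ C; have ZZ := cycleZ C.
have XY := joinXY C; have XZ := joinXZ C; have YZ := joinYZ C.
have cov : indep (fun j => ~~ (c (X x) (Z j) || c (X y) (Z j))).
  by move=> j k jk; rewrite !negb_or; apply: (red_cover (mono_swap M) xy).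
have ired j : c (X x) (Z j) || c (X y) (Z j) -> ~~ c (Y i) (Z j).
  by case/orP=> ?; apply/negP => ?; [apply: (@no_blue (X x) (Y i) (Z j))
                                   |apply: (@no_blue (X y) (Y i) (Z j))]; auto.
have [j [k [jk /ired ij /ired ik]]] := cover_edge cov.
apply: (@no_red w (Y i) (Z j) (Z k)); auto.
exact: mono_red (mono_swap M) _ _ jk.
Qed.

(** Let x and t be the neighbours of y, and suppose that an edge ij of Y has i
    blue to x and j blue to t. A blue neighbour k of x in Z that is red to y is
    red to i, hence not blue to t, as otherwise w, i, j, k would be a red
    4-clique. So i and k are both missed by yt, and their edge is blue: a contradiction. *)
Lemma mono_red_False X Y Z : mono X Y Z false -> False.
Proof.
move=> M; have M' := mono_swap M.
have C := mono_cone M; have wX := mono_X M; have wY := mono_Y M; have wZ := mono_Z M.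
have aY := apexY C; have aZ := apexZ C; have YY := cycleY C.
have XY := joinXY C; have XZ := joinXZ C; have YZ := joinYZ C.
have redAA x i j : c (X x) (Y i) -> c (X x) (Z j) -> ~~ c (Y i) (Z j).
  by move=> xi xj; apply/negP => ?; apply: (@no_blue (X x) (Y i) (Z j)); auto.
apply: (@no_pentagram (fun x i => c (X x) (Y i))); first exact: red_cover M.
move=> x y t i j xy yt ij xi tj.
have [k [xk yk]] : exists k, c (X x) (Z k) /\ ~~ c (X y) (Z k).
  case: (pickP (fun k => c (X x) (Z k) && ~~ c (X y) (Z k))) => [k /andP[]|no].
    by exists k.
  have cov : indep (fun l => ~~ c (X y) (Z l)).
    move=> l m lm nl nm; apply: (red_cover M' xy lm).
      by move: (no l); rewrite nl andbT => ->.
    by move: (no m); rewrite nm andbT => ->.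
  have [l []] := indep_missed (@red_indep _ _ _ M' y) cov.
  by case: (c (X y) (Z l)).
have nij := mono_red M ij.
have nik := redAA x i k xi xk.
have ntk : ~~ c (X t) (Z k).
  apply/negP => tk; have njk := redAA t j k tj tk.
  by apply: (@no_red w (Y i) (Y j) (Z k)); auto.
have nti : ~~ c (X t) (Y i) by apply/negP => ti; apply: (red_indep M ij ti tj).
have nyi := red_disjoint M xy xi.
by case/negP: nik; apply: (blue_near C wX yt); auto.
Qed.

(** ** Both cycles blue *)

(** Suppose that an edge ij of Y has i missed by xy and j missed by xt. A vertex
    k of Z missed by xy is blue to i. Now i is blue to t, so k is not, hence k
    is missed by xt and is blue to j too, and i, j, k is a blue triangle. *)
Lemma mono_blue_False X Y Z : mono X Y Z true -> False.
Proof.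
move=> M; have C := mono_cone M; have wX := mono_X M.
have YY := cycleY C; have ZZ := cycleZ C.
have XY := joinXY C; have XZ := joinXZ C; have YZ := joinYZ C.
have bY i j : i -- j -> c (Y i) (Y j) by move=> ij; rewrite (mono_YY M ij).
have bZ i j : i -- j -> c (Z i) (Z j) by move=> ij; rewrite (mono_ZZ M ij).
have indY x : indep (fun i => c (X x) (Y i)).
  by move=> i j ij xi xj; apply: (@no_blue (X x) (Y i) (Y j)); auto.
have indZ x : indep (fun i => c (X x) (Z i)).
  by move=> i j ij xi xj; apply: (@no_blue (X x) (Z i) (Z j)); auto.
have bPP x y i j : x -- y -> ~~ c (X x) (Y i) -> ~~ c (X y) (Y i) ->
    ~~ c (X x) (Z j) -> ~~ c (X y) (Z j) -> c (Y i) (Z j).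
  by move=> xy *; apply: (blue_near C wX xy); auto.
have covY x y : x -- y -> indep (fun i => ~~ c (X x) (Y i) && ~~ c (X y) (Y i)).
  move=> xy i j ij /andP[xi yi] /andP[xj yj].
  have [k [xk yk]] := indep_missed (indZ x) (indZ y).
  by apply: (@no_blue (Y i) (Y j) (Z k)); auto; apply: (bPP x y).
apply: (@no_alternation (fun x i => c (X x) (Y i))) => // x y t i j xy xt ij xi yi xj tj.
have [k [xk yk]] := indep_missed (indZ x) (indZ y).
have ik : c (Y i) (Z k) by apply: (bPP x y).
have ti : c (X t) (Y i).
  by apply/negPn/negP => nti; apply: (covY x t xt i j ij); rewrite ?xi ?nti ?xj ?tj.
have ntk : ~~ c (X t) (Z k).
  by apply/negP => tk; apply: (@no_blue (X t) (Y i) (Z k)); auto.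
by apply: (@no_blue (Y i) (Y j) (Z k)); auto; apply: (bPP x t).
Qed.

(** * The colours at the apex *)

(** In each cycle some edge is red to w. The six ends of these three edges form
    a K_6, in which x has three edges of one colour. *)
Lemma no_red_K6 X Y Z : cone w X Y Z -> indep (fun i => c w (X i)) ->
  indep (fun i => c w (Y i)) -> indep (fun i => c w (Z i)) -> False.
Proof.
move=> C indX indY indZ.
have red_edge (U : 'I_5 -> G) : indep (fun i => c w (U i)) ->
    exists i j, [/\ i -- j, ~~ c w (U i) & ~~ c w (U j)].
  by move=> indU; apply: cover_edge => i j ij /negPn wi /negPn wj; apply: indU ij wi wj.
have [x [x' [xx wx wx']]] := red_edge X indX.
have [y [y' [yy wy wy']]] := red_edge Y indY.
have [z [z' [zz wz wz']]] := red_edge Z indZ.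
have aX := apexX C; have aY := apexY C; have aZ := apexZ C.
have XX := cycleX C xx; have YY := cycleY C yy; have ZZ := cycleZ C zz.
have XY := joinXY C; have XZ := joinXZ C; have YZ := joinYZ C.
have Bx' : red_nbr (X x') by [].
have By : red_nbr (Y y) by []. have By' : red_nbr (Y y') by [].
have Bz : red_nbr (Z z) by []. have Bz' : red_nbr (Z z') by [].
pose T a b d := ~~ ((c (X x) a == c (X x) b) && (c (X x) a == c (X x) d)).
have S a b d : red_nbr a -> red_nbr b -> red_nbr d ->
    adj (X x) a -> adj (X x) b -> adj (X x) d -> adj a b -> adj a d -> adj b d -> T a b d.
  by move=> *; apply/negP => /andP[/eqP e1 /eqP e2]; apply: (@red_nbr_star (X x) a b d).
have : [&& T (X x') (Y y) (Y y'), T (X x') (Z z) (Z z'), T (X x') (Y y) (Z z),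
           T (X x') (Y y) (Z z'), T (X x') (Y y') (Z z), T (X x') (Y y') (Z z'),
           T (Y y) (Y y') (Z z), T (Y y) (Y y') (Z z'), T (Y y) (Z z) (Z z')
         & T (Y y') (Z z) (Z z')].
  by rewrite !S.
rewrite /T; case: (c (X x) (X x')); case: (c (X x) (Y y)); case: (c (X x) (Y y'));
by case: (c (X x) (Z z)); case: (c (X x) (Z z')).
Qed.

(** If v in Y is blue to w, then one of the two paths of length two that leave v
    along Y has its last vertex red to w, since these last vertices are
    adjacent. *)
Lemma no_split X Y Z : cone w X Y Z -> (forall i, c w (X i)) ->
  indep (fun i => c w (Y i)) -> (forall i, ~~ c w (Z i)) -> False.
Proof.
move=> C wX wY wZ; case: (pickP (fun i => c w (Y i))) => [v wv|no].
  have nw i : v -- i -> ~~ c w (Y i) by move=> vi; apply/negP; apply: wY vi wv.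
  have [k1 [k2 [k3 [k4 [e1 e2 e3 e4 e5]]]]] := C5_walk v.
  have [w2|n2] := boolP (c w (Y k2)).
    have n3 : ~~ c w (Y k3) by apply/negP; apply: wY e3 w2.
    by apply: (blue_in_Y_False C wX wZ (v := v) (b := k4) (a := k3)); auto.
  by apply: (blue_in_Y_False C wX wZ (v := v) (b := k1) (a := k2)); auto.
have [i|[] M] := red_nbr_mono C wX _ wZ; first by rewrite no.
  exact: mono_blue_False M.
exact: mono_red_False M.
Qed.

(** Blue neighbours of w contain no 4-clique. With x0 and x1 already among them,
    those in Y or in Z are independent, and one of Y and Z has none. If w were
    red to some x in X, then x, an edge of the other cycle red to w and the
    cycle red to w would form K_3 + C_5 in the red neighbourhood of w, where
    [red_nbr_fan] makes the triangle monochromatic. *)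
Lemma blue_edge_False X Y Z x0 x1 : cone w X Y Z -> x0 -- x1 -> c w (X x0) -> c w (X x1) ->
  False.
Proof.
move=> C x01 b0 b1.
have aX := apexX C; have aY := apexY C; have aZ := apexZ C.
have XX := cycleX C; have YY := cycleY C; have ZZ := cycleZ C.
have XY := joinXY C; have XZ := joinXZ C; have YZ := joinYZ C.
have ww := @red_between w.
have indY : indep (fun i => c w (Y i)).
  by move=> i j ij wi wj; apply: (@no_red (X x0) (X x1) (Y i) (Y j)); auto.
have indZ : indep (fun i => c w (Z i)).
  by move=> i j ij wi wj; apply: (@no_red (X x0) (X x1) (Z i) (Z j)); auto.
have clash i j : c w (Y i) -> c w (Z j) -> False.
  by move=> wi wj; apply: (@no_red (X x0) (X x1) (Y i) (Z j)); auto.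
have main U V : cone w X U V -> indep (fun i => c w (U i)) ->
    (forall i, ~~ c w (V i)) -> False.
  move=> C' indU wV; apply: (no_split C') => // x; apply/negPn/negP => nx.
  have [i [j [ij ni nj]]] : exists i j, [/\ i -- j, ~~ c w (U i) & ~~ c w (U j)].
    apply: cover_edge => i j ij /negPn wi /negPn wj; exact: indU ij wi wj.
  have XU := joinXY C'; have XV := joinXZ C'; have UV := joinYZ C'.
  have UU := cycleY C'; have VV := cycleZ C'.
  have Bi : red_nbr (U i) by split=> //; apply: apexY C' _.
  have Bj : red_nbr (U j) by split=> //; apply: apexY C' _.
  have Bx : red_nbr (X x) by split.
  have BV k : red_nbr (V k) by split=> //; apply: apexZ C' _.
  apply: (@red_nbr_triangle (X x) (U i) (U j)); auto.
    by apply: (@red_nbr_fan _ _ _ V); auto.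
  by rewrite cC; apply: (@red_nbr_fan _ _ _ V); auto.
case: (pickP (fun i => c w (Z i))) => [j wj|no].
  apply: (main Z Y) => // [|i]; first exact: cone_swapYZ.
  by apply/negP => wi; apply: clash wi wj.
by apply: (main Y Z) => // i; rewrite no.
Qed.

Lemma cone_False X Y Z : cone w X Y Z -> False.
Proof.
move=> C.
have [[i [j [ij wi wj]]]|indX] := indepP (fun i => c w (X i)).
  exact: blue_edge_False C ij wi wj.
have [[i [j [ij wi wj]]]|indY] := indepP (fun i => c w (Y i)).
  exact: blue_edge_False (cone_swapXY C) ij wi wj.
have [[i [j [ij wi wj]]]|indZ] := indepP (fun i => c w (Z i)).
  exact: blue_edge_False (cone_swapXY (cone_swapYZ C)) ij wi wj.
exact: no_red_K6 C indX indY indZ.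
Qed.
End RedNeighbourhood.
End Coloring.

Theorem mainTheorem1 :
  arrows (complete_graph 1 + cycle_graph 5 + cycle_graph 5 + cycle_graph 5)%graph
    3 4.
Proof.
set G := (_ + _)%graph; case=> E1 [E2 [[edgesE _] [nblue nred]]].
pose c : rel G := fun u v => [set u; v] \in E1.
have cC : symmetric c by move=> u v; rewrite /c setUC.
have neq (u v : G) : adj u v -> u != v.
  by move=> uv; apply/eqP => uv'; move: uv; rewrite uv' adj_irr.
have redE u v : adj u v -> ~~ c u v -> [set u; v] \in E2.
  move=> uv nuv; have: [set u; v] \in edges G by apply/imset2P; exists u v.
  by rewrite edgesE inE => /orP[uv1|//]; case/negP: nuv.
have E2C (u v : G) : [set u; v] \in E2 -> [set v; u] \in E2 by rewrite setUC.
pose w : G := inl (inl (inl ord0)).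
pose X : 'I_5 -> G := fun i => inl (inl (inr i)).
pose Y : 'I_5 -> G := fun i => inl (inr i).
pose Z : 'I_5 -> G := fun i => inr i.
apply: (@cone_False G c cC _ _ w X Y Z); last by split.
  move=> u v t uv ut vt cuv cut cvt; apply: nblue; exists [set u; v; t].
  have [vu tu tv] : [/\ adj v u, adj t u & adj t v] by split; apply: adjC.
  split; first split.
  - by rewrite setUC cardsU1 cards2 !inE negb_or ![t == _]eq_sym !neq.
  - move=> x y; rewrite !inE -!orbA.
    by case/or3P=> /eqP-> /or3P[] /eqP-> //; rewrite eqxx.
  move=> x y; rewrite !inE -!orbA.
  by case/or3P=> /eqP-> /or3P[] /eqP-> //; rewrite ?adj_irr // -/(c _ _) cC.
move=> u v t s uv ut us vt vs ts nuv nut nus nvt nvs nts.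
apply: nred; exists [set u; v; t; s].
have [vu tu su] : [/\ adj v u, adj t u & adj s u] by split; apply: adjC.
have [tv sv st] : [/\ adj t v, adj s v & adj s t] by split; apply: adjC.
split; first split.
- rewrite setUC cardsU1 [_ :|: [set t]]setUC cardsU1 cards2 !inE !negb_or.
  by rewrite !neq.
- move=> x y; rewrite !inE -!orbA.
  by case/or4P=> /eqP-> /or4P[] /eqP-> //; rewrite eqxx.
move=> x y; rewrite !inE -!orbA.
by case/or4P=> /eqP-> /or4P[] /eqP-> //; rewrite ?adj_irr // => _; auto.
Qed.
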